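(* Let $F,G\in\mathbb{R}^{m\times m}$ with $\det F=0$ and with $sF-G$ a regular pencil, and consider the system $FY_{k+1}=GY_k$, $k=0,1,2,\dots$, with non-consistent initial conditions $Y_0\in\mathbb{R}^m$. Let $Q_p$ and $J_p$ be the matrices obtained from the Weierstrass canonical form of the pencil, and for each non-consistent $Y_0$ let the optimal solution be $$\hat Y_k=Q_pJ_p^k(Q_p^*Q_p)^{-1}Q_p^*Y_0,\qquad k\ge 0.$$ Then the system is asymptotically stable at large if and only if all the finite eigenvalues of $sF-G$ lie within the open disc $|s|<1$.
   Context: The pencil $sF-G$ is regular if $\det(sF-G)$ is not identically zero as a polynomial in $s\in\mathbb{C}$. Its finite eigenvalues are the roots $s\in\mathbb{C}$ of $\det(sF-G)$; $p$ is the number of them counted with algebraic multiplicity, and $q=m-p$ is the algebraic multiplicity of the infinite eigenvalue. Weierstrass canonical form: by regularity there are non-singular matrices $P,Q\in\mathbb{C}^{m\times m}$ such that $$PFQ=\begin{bmatrix} I_p&0_{p,q}\\0_{q,p}&H_q\end{bmatrix},\qquad PGQ=\begin{bmatrix} J_p&0_{p,q}\\0_{q,p}&I_q\end{bmatrix},$$ where $H_q$ is nilpotent and $J_p$ is a $p\times p$ Jordan matrix whose eigenvalues are the finite eigenvalues of the pencil. Such $P,Q$ are fixed, and $Q$ is partitioned as $Q=[\,Q_p\ \ Q_q\,]$ with $Q_p$ of size $m\times p$ and $Q_q$ of size $m\times q$. Here $^*$ denotes conjugate transpose. An initial condition $Y_0\in\mathbb{R}^m$ is consistent if the system has a solution $(Y_k)_{k\ge0}$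 starting at $Y_0$; equivalently, $Y_0\in\mathrm{colspan}\,Q_p$. It is non-consistent otherwise, i.e. if $Y_0\notin\mathrm{colspan}\,Q_p$. For non-consistent $Y_0$, the optimal solution $\hat Y_k$ is the solution of the system starting at the consistent vector $\hat Y_0$ that minimizes $\|Y_0-\hat Y_0\|_2$; it is given by the formula in the claim. A vector $Y_*\in\mathbb{R}^m$ is an equilibrium state if it is a consistent initial condition and $Y_0=Y_*$ implies $Y_k=Y_*$ for all $k\ge1$. The system is asymptotically stable at large (with respect to the optimal solutions) if there is an equilibrium state $Y_*$, not depending on $Y_0$, such that $\lim_{k\to\infty}\hat Y_k=Y_*$ for every non-consistent initial condition $Y_0\in\mathbb{R}^m$. *)

(* Defs.v *)
From HB Require Import structures.
From mathcomp Require Import all_boot all_order all_algebra.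
From mathcomp Require Import all_classical all_reals all_analysis.
From mathcomp Require Import complex.

Set Implicit Arguments.
Unset Strict Implicit.
Unset Printing Implicit Defensive.

Import Order.TTheory GRing.Theory Num.Theory.
Import numFieldNormedType.Exports.

Local Open Scope classical_set_scope.
Local Open Scope ring_scope.
Local Open Scope sesquilinear_scope.

(* R[i] itself carries no topology in the library; seen as a
   numClosedFieldType it inherits the generic norm topology, and so do the
   matrices over it. *)
Definition Cplx (R : realType) : numClosedFieldType := R[i].

Definition mxC (R : realType) m n (A : 'M[R]_(m, n)) : 'M[Cplx R]_(m, n) :=
  map_mx (real_complex R) A.

Section Pencil.
Context {R : realType} {m : nat}.
Implicit Types (F G : 'M[R]_m).

(* det(sF - G), as a polynomial in s over the complex numbers *)
Definition pencil_det F G : {poly Cplx R} :=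
  \det ('X *: map_mx polyC (mxC F) - map_mx polyC (mxC G)).

Definition regular_pencil F G := pencil_det F G != 0.

Definition finite_eigenvalue F G (s : Cplx R) := root (pencil_det F G) s.

(* The roots of det(sF - G), each listed as many times as its algebraic
   multiplicity (meaningful for a regular pencil only). *)
Definition finite_eigenvalues F G : seq (Cplx R) :=
  sval (closed_field_poly_normal (pencil_det F G)).

Definition num_finite_eigenvalues F G : nat := size (finite_eigenvalues F G).

End Pencil.

Definition jordan_block {K : nzRingType} (d : nat) (a : K) : 'M[K]_d :=
  \matrix_(i, j) (a *+ (i == j) + (i.+1 == j :> nat)%:R).

Definition jordan_matrix {K : nzRingType} (p : nat) (J : 'M[K]_p) : Prop :=
  exists (n : nat) (d : 'I_n -> nat) (a : 'I_n -> K)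
         (e : (\sum_(i < n) d i)%N = p),
    (forall i, (0 < d i)%N) /\
    J = castmx (e, e) (\mxdiag_(i < n) jordan_block (d i) (a i)).

Definition nilpotent_matrix {K : nzRingType} (q : nat) (H : 'M[K]_q) : Prop :=
  exists n : nat, H ^+ n = 0.

Definition weierstrass_form {R : realType} {m p q : nat} (e : (p + q)%N = m)
    (F G : 'M[R]_m) (P Q : 'M[Cplx R]_m)
    (J : 'M[Cplx R]_p) (H : 'M[Cplx R]_q) : Prop :=
  [/\ P \in unitmx /\ Q \in unitmx,
      P *m mxC F *m Q = castmx (e, e) (block_mx 1%:M 0 0 H),
      P *m mxC G *m Q = castmx (e, e) (block_mx J 0 0 1%:M),
      nilpotent_matrix H
    & jordan_matrix J /\ forall s, eigenvalue J s = finite_eigenvalue F G s].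

Section System.
Context {R : realType} {m : nat}.
Implicit Types (F G : 'M[R]_m) (Y : nat -> 'cV[R]_m) (y : 'cV[R]_m).

Definition is_solution F G Y : Prop := forall k, F *m Y k.+1 = G *m Y k.

Definition consistent F G y : Prop :=
  exists Y, Y 0%N = y /\ is_solution F G Y.

Definition equilibrium F G (Ystar : 'cV[R]_m) : Prop :=
  consistent F G Ystar /\
  forall Y, is_solution F G Y -> Y 0%N = Ystar ->
    forall k, (1 <= k)%N -> Y k = Ystar.

Definition optimal_solution {p} (Qp : 'M[Cplx R]_(m, p)) (J : 'M[Cplx R]_p)
    y (k : nat) : 'cV[Cplx R]_m :=
  Qp *m J ^+ k *m invmx (Qp ^t* *m Qp) *m Qp ^t* *m mxC y.

Definition asymptotically_stable_at_large F G {p}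
    (Qp : 'M[Cplx R]_(m, p)) (J : 'M[Cplx R]_p) : Prop :=
  exists Ystar : 'cV[R]_m, equilibrium F G Ystar /\
    forall y, ~ consistent F G y ->
      optimal_solution Qp J y @ \oo --> mxC Ystar.

End System.

(* Main.v *)
Require Import Defs.
From mathcomp Require Import all_boot all_order all_algebra.
From mathcomp Require Import all_classical all_reals all_analysis.
From mathcomp Require Import complex.
From mathcomp Require Import lra.

Set Implicit Arguments.
Unset Strict Implicit.
Unset Printing Implicit Defensive.

Import Order.TTheory GRing.Theory Num.Theory.
Import numFieldNormedType.Exports.

Local Open Scope classical_set_scope.
Local Open Scope ring_scope.
Local Open Scope sesquilinear_scope.

(** Write [T k = Qp *m J^k *m L] with [L = (Qp^* Qp)^-1 Qp^*], so that the
optimal solution is [T k *m y]. Since [Q] is invertible, [Qp] is injective,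
its Gram matrix [Qp^* Qp] is invertible ([gram_unitmx]) and [L] is a left
inverse of [Qp]; hence [T k] tends to zero exactly when [J^k] does, and the
eigenvalues of [J] are the finite eigenvalues of the pencil.

If these lie in the open unit disc, [J^k] tends to zero
([spectral_radius_lt1_cvg0]): by Cayley-Hamilton the product of the [J - a]
over the roots [a] of the characteristic polynomial vanishes, and its factors
can be removed one at a time, because [x_(k+1) - a x_k -> 0] with [|a| < 1]
forces [x_k -> 0] ([first_order_recurrence_cvg0]). The limit state is then
[0], which is an equilibrium because only the zero solution starts at it
([zero_solution_unique]): in Weierstrass coordinates the finite part is
propagated forwards by [J], and the infinite part is [H^n] applied to a later
state.

Conversely, suppose that all optimal solutions from non-consistent states have
the same limit [Ystar]. The difference of two such solutions tends to zero.
The consistent states form a linear subspace, which is proper because [F] is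
singular and the pencil regular ([exists_nonconsistent]), and the complement
of a proper subspace has every vector as a difference of two of its elements.
So [T k *m y] tends to zero for every [y], hence so do [T k] and [J^k = L *m T
k *m Qp], and no eigenvalue of [J] can have modulus at least 1
([eigenvalue_norm_lt1]). *)

(** * Entrywise convergence of matrices *)

Lemma cvg_mxP (T : topologicalType) (I : Type) (F : set_system I)
    (FF : Filter F) (m n : nat) (X : I -> 'M[T]_(m, n)) (A : 'M[T]_(m, n)) :
  (X k @[k --> F] --> A) <->
  (forall i j, (X k i j @[k --> F] --> A i j)).
Proof.
split=> [XA i j B AB|XA B [P AP sPB]].
  apply: (XA [set M | B (M i j)]%classic).
  exists (fun i' j' => if (i' == i) && (j' == j) then B else setT).
    by move=> i' j'; case: andP => [[/eqP-> /eqP->]|_] //; exact: filterT.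
  by move=> M /(_ i j); rewrite !eqxx.
suff : \forall k \near F, forall i j, P i j (X k i j).
  by apply: filterS => k Pk; exact: sPB.
apply: filter_forall => i; apply: filter_forall => j.
exact: (XA i j _ (AP i j)).
Qed.

Lemma cvg_mulmxl (K : numFieldType) (l m n : nat) (B : 'M[K]_(l, m))
    (X : nat -> 'M[K]_(m, n)) (A : 'M[K]_(m, n)) :
  (X k @[k --> \oo] --> A) ->
  (B *m X k @[k --> \oo] --> B *m A).
Proof.
move=> /cvg_mxP XA; apply/cvg_mxP => i j; rewrite mxE.
under eq_fun do rewrite mxE.
apply: cvg_big => [|h _]; first exact: add_continuous.
by apply: cvgMl_tmp; exact: XA.
Qed.

Lemma cvg_mulmxr (K : numFieldType) (l m n : nat) (B : 'M[K]_(m, n))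
    (X : nat -> 'M[K]_(l, m)) (A : 'M[K]_(l, m)) :
  (X k @[k --> \oo] --> A) ->
  (X k *m B @[k --> \oo] --> A *m B).
Proof.
move=> /cvg_mxP XA; apply/cvg_mxP => i j; rewrite mxE.
under eq_fun do rewrite mxE.
apply: cvg_big => [|h _]; first exact: add_continuous.
by apply: cvgMr_tmp; exact: XA.
Qed.

(** * Convergence of first-order recurrences *)

(** Given [e > 0], from an index [N] on [v] stays below [(1 - r) * (e / 2)], so
that [e / 2] is a supersolution of the recurrence and [u] exceeds it by at most
a geometric sequence. *)
Lemma affine_recurrence_cvg0 (R : realType) (r : R) (u v : nat -> R) :
  0 <= r < 1 -> (forall k, 0 <= u k) ->
  (forall k, u k.+1 <= r * u k + v k) ->
  (v k @[k --> \oo] --> 0) -> (u k @[k --> \oo] --> 0).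
Proof.
move=> /andP[r0 r1] u0 uS v0; apply/cvgr0Pnorm_lt => e e0.
have d0 : 0 < (1 - r) * (e / 2).
  by rewrite mulr_gt0 ?subr_gt0 ?divr_gt0.
have [N _ vN] := (cvgr0Pnorm_lt _).1 v0 _ d0.
have uN j : u (N + j)%N <= r ^+ j * u N + e / 2.
  elim: j => [|j IH].
    by rewrite addn0 expr0 mul1r lerDl divr_ge0 ?ltW.
  have := vN (N + j)%N (leq_addr _ _) => /ltr_normlW vj.
  have := uS (N + j)%N; have := ler_wpM2l r0 IH.
  rewrite addnS exprS; set t := r ^+ j * u N; rewrite -mulrA -/t; lra.
have rN : (r ^+ j * u N @[j --> \oo] --> 0).
  rewrite -[0](mul0r (u N)); apply: cvgMr_tmp.
  by apply: cvg_expr; rewrite ger0_norm.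
have e20 : 0 < e / 2 by rewrite divr_gt0.
have [M _ rM] := (cvgr0Pnorm_lt _).1 rN _ e20.
exists (N + M)%N => // k /= NMk.
rewrite ger0_norm ?u0 // -(subnKC (leq_trans (leq_addr M N) NMk)).
have Mk : (M <= k - N)%N by rewrite leq_subRL ?(leq_trans (leq_addr M N) NMk).
have /ltr_normlW := rM _ Mk; have := uN (k - N)%N; lra.
Qed.

Lemma normc_normE (R : realType) (z : Cplx R) : `|z| = (Normc.normc z)%:C%C.
Proof. by []. Qed.

Lemma normc_ge0 (R : realType) (z : Cplx R) : 0 <= Normc.normc z.
Proof. by have := normr_ge0 z; rewrite normc_normE lecR. Qed.

(** Reduces complex sequences to real ones, since the estimate by a geometric
sequence relies on the archimedean property of [R]. *)
Lemma cvg_Cplx0P (R : realType) (z : nat -> Cplx R) :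
  (z k @[k --> \oo] --> 0) <->
  (Normc.normc (z k) @[k --> \oo] --> 0).
Proof.
split=> z0; apply/cvgr0Pnorm_lt => e e0.
  move/cvgr0Pnorm_lt: z0 => /(_ ((e : R)%:C)%C); rewrite ltcR => /(_ e0).
  by apply: filterS => k; rewrite normc_normE ltcR ger0_norm ?normc_ge0.
have eE : (e : Cplx R) = (complex.Re (e : Cplx R))%:C%C.
  by apply/esym/RRe_real/gtr0_real.
rewrite eE; have re0 : 0 < complex.Re (e : Cplx R) by rewrite -ltcR -eE.
move/cvgr0Pnorm_lt: z0 => /(_ _ re0).
by apply: filterS => k; rewrite normc_normE ltcR ger0_norm ?normc_ge0.
Qed.

Lemma first_order_recurrence_cvg0 (R : realType) (a : Cplx R)
    (x : nat -> Cplx R) :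
  `|a| < 1 -> (x k.+1 - a * x k @[k --> \oo] --> 0) ->
  (x k @[k --> \oo] --> 0).
Proof.
move=> a1 /cvg_Cplx0P xa; apply/cvg_Cplx0P.
apply: (@affine_recurrence_cvg0 _ (Normc.normc a) _
  (fun k => Normc.normc (x k.+1 - a * x k))); last exact: xa.
- by rewrite normc_ge0 -ltcR -normc_normE.
- by move=> k; exact: normc_ge0.
move=> k; rewrite -lecR rmorphD rmorphM /= -!normc_normE -normrM.
by rewrite -{1}(subrK (a * x k) (x k.+1)) addrC ler_normD.
Qed.

(** * Powers of a matrix and its spectrum *)

(** The factor [B] makes the induction on [rs] work: the induction hypothesis
for [B *m (J - a%:M)] says that the entries [x_k] of [B *m J ^+ k] satisfy
[x_(k+1) - a x_k -> 0]. *)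
Lemma mulmx_expr_cvg0 (R : realType) (m p : nat) (J : 'M[Cplx R]_p.+1)
    (rs : seq (Cplx R)) (B : 'M[Cplx R]_(m, p.+1)) :
  (forall a, a \in rs -> `|a| < 1) ->
  B *m \prod_(a <- rs) (J - a%:M) = 0 ->
  (B *m J ^+ k @[k --> \oo] --> (0 : 'M[Cplx R]_(m, p.+1))).
Proof.
elim: rs B => [|a rs IH] B rs1.
  rewrite big_nil mulmx1 => ->.
  by under eq_fun do rewrite mul0mx; exact: cvg_cst.
rewrite big_cons mulmxA => /IH BJ.
have {BJ}/cvg_mxP BJ := BJ (fun b brs => rs1 b (mem_behead (s := a :: rs) brs)).
apply/cvg_mxP => i j; rewrite mxE.
apply: (@first_order_recurrence_cvg0 _ a).
  by apply: rs1; rewrite mem_head.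
have := BJ i j; rewrite mxE.
under eq_fun do rewrite mulmxBr mulmxBl mul_mx_scalar -scalemxAl -mulmxA mxE
  [in X in _ + X]mxE [in X in _ - X]mxE.
by under [in X in _ -> X]eq_fun do rewrite exprS.
Qed.

Lemma spectral_radius_lt1_cvg0 (R : realType) (p : nat) (J : 'M[Cplx R]_p) :
  (forall s, eigenvalue J s -> `|s| < 1) ->
  (J ^+ k @[k --> \oo] --> (0 : 'M[Cplx R]_p)).
Proof.
case: p J => [|p] J J1.
  by apply/cvg_mxP => -[].
have [rs Jrs] := closed_field_poly_normal (char_poly J).
have rs1 a : a \in rs -> `|a| < 1.
  move=> ars; apply: J1; rewrite eigenvalue_root_char Jrs.
  rewrite rootZ ?root_prod_XsubC //.
  by rewrite lead_coef_eq0 monic_neq0 ?char_poly_monic.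
under eq_fun do rewrite -[_ ^+ _]mul1mx.
apply: mulmx_expr_cvg0 rs1 _; rewrite mul1mx.
have := Cayley_Hamilton J; rewrite Jrs (monicP (char_poly_monic J)) scale1r.
rewrite rmorph_prod.
under eq_bigr do rewrite rmorphB /= horner_mx_X horner_mx_C.
by [].
Qed.

(** If a row [w] kills [A ^t* *m A], then [w *m A ^t*] is orthogonal to
itself. *)
Lemma gram_unitmx (C : numClosedFieldType) (m p : nat) (A : 'M[C]_(m, p))
    (L : 'M[C]_(p, m)) :
  L *m A = 1%:M -> A ^t* *m A \in unitmx.
Proof.
move=> LA; rewrite -row_free_unit -kermx_eq0; apply/rowV0P => w /sub_kermxP wG.
have wA : w *m A ^t* = 0.
  apply/eqP; rewrite -(dnorm_eq0 (@dotmx C m)); apply/eqP.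
  rewrite [LHS]dotmxE trmx_mul map_mxM map_trmx trmxK map_mxCK mulmxA.
  by rewrite -(mulmxA w) wG mul0mx mxE.
have : w *m (L *m A) ^t* = 0 by rewrite trmx_mul map_mxM mulmxA wA mul0mx.
by rewrite LA trmx1 map_mx1 mulmx1.
Qed.

(** On an eigenvector [v] for [s], [J ^+ k] acts as [s ^+ k]; if [`|s|] were at
least 1, a nonzero entry of [v *m J ^+ k] could not become smaller than that
of [v]. *)
Lemma eigenvalue_norm_lt1 (C : numClosedFieldType) (p : nat) (J : 'M[C]_p)
    (s : C) :
  (J ^+ k @[k --> \oo] --> (0 : 'M[C]_p)) -> eigenvalue J s -> `|s| < 1.
Proof.
move=> /(@cvg_mulmxl _ 1 _ _ _ _ _) J0 /eigenvalueP[v vJ v0].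
have {J0} /cvg_mxP J0 := J0 v.
have vJk k : v *m J ^+ k = s ^+ k *: v.
  elim: k => [|k IH]; first by rewrite !expr0 mulmx1 scale1r.
  by rewrite exprS -[_ * _]/(_ *m _) mulmxA vJ -scalemxAl IH scalerA -exprS.
have /rV0Pn [i vi] := v0.
rewrite real_ltNge ?real1 ?normr_real //; apply/negP => s1.
have := J0 0 i; rewrite mulmx0 mxE => /cvgr0Pnorm_lt /(_ `|v 0 i|).
rewrite normr_gt0 => /(_ vi) [N _ /(_ N (leqnn N))].
rewrite vJk mxE normrM normrX real_ltNge ?realM ?realX ?normr_real //.
by rewrite ler_peMl // exprn_ege1.
Qed.

(** * Consistent initial states *)

Section Consistency.
Context {R : realType} {m : nat}.
Implicit Types (F G : 'M[R]_m) (y z : 'cV[R]_m).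

Lemma consistentZ F G a y : consistent F G y -> consistent F G (a *: y).
Proof.
move=> [Y [<- Ysol]]; exists (fun k => a *: Y k); split=> // k.
by rewrite -!scalemxAr Ysol.
Qed.

Lemma consistentB F G y z :
  consistent F G y -> consistent F G z -> consistent F G (y - z).
Proof.
move=> [Y [<- Ysol]] [Z [<- Zsol]]; exists (fun k => Y k - Z k); split=> // k.
by rewrite !mulmxBr Ysol Zsol.
Qed.

(** If every state were consistent, the first step of the solutions starting at
the basis vectors would give a matrix [M] with [G = F *m M], so that
[det (s F - G) = det F * det (s - M)] would vanish identically. *)
Lemma exists_nonconsistent F G :
  \det F = 0 -> regular_pencil F G -> exists y, ~ consistent F G y.
Proof.
move=> F0 /negP regFG; apply: contrapT => noy; apply: regFG.
have : forall j : 'I_m, exists x : 'cV[R]_m, F *m x = G *m delta_mx j 0.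
  move=> j; have [Y [<- Ysol]] : consistent F G (delta_mx j 0).
    by apply: contrapT => yN; apply: noy; exists (delta_mx j 0).
  by exists (Y 1%N); rewrite Ysol.
move=> /choice[x Fx].
pose M : 'M[R]_m := \matrix_(i, j) x j i 0.
have GE : G = F *m M.
  apply/matrixP => i j.
  have /matrixP/(_ i 0) := Fx j; rewrite -colE !mxE => <-.
  by apply: eq_bigr => h _; rewrite mxE.
rewrite /pencil_det GE /mxC map_mxM map_mxM /= -mul_mx_scalar /=.
rewrite -mulmxBr.
by rewrite det_mulmx !det_map_mx F0 !rmorph0 mul0r.
Qed.

End Consistency.

(** In the coordinates [Q^-1 y], the component [u] obeys [u_(k+1) = J u_k] and
starts at [0], while the component [d] obeys [d_k = H d_(k+1)], hence
[d_k = H^n d_(k+n) = 0]. *)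
Lemma descriptor_sequence_eq0 (K : fieldType) (p q n : nat)
    (A B P Q : 'M[K]_(p + q)) (J : 'M[K]_p) (H : 'M[K]_q)
    (y : nat -> 'cV[K]_(p + q)) :
  Q \in unitmx -> P *m A *m Q = block_mx 1%:M 0 0 H ->
  P *m B *m Q = block_mx J 0 0 1%:M -> H ^+ n = 0 ->
  (forall k, A *m y k.+1 = B *m y k) -> y 0%N = 0 -> forall k, y k = 0.
Proof.
move=> Qu AE BE Hn yS y0.
pose z k := invmx Q *m y k.
pose u k := usubmx (z k); pose d k := dsubmx (z k).
have Qz k : y k = Q *m z k by rewrite mulKVmx.
have rec k : u k.+1 = J *m u k /\ d k = H *m d k.+1.
  have : P *m A *m Q *m z k.+1 = P *m B *m Q *m z k.
    by rewrite -!mulmxA -!Qz yS.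
  rewrite AE BE -(vsubmxK (z k.+1)) -(vsubmxK (z k)) !mul_block_col.
  by rewrite !mul1mx !mul0mx !addr0 !add0r => /eq_col_mx[].
have u0 k : u k = 0.
  elim: k => [|k IH]; last by rewrite (rec k).1 IH mulmx0.
  by rewrite /u /z y0 mulmx0 linear0.
have dH j k : d k = H ^+ j *m d (k + j)%N.
  elim: j k => [|j IH] k; first by rewrite expr0 mul1mx addn0.
  by rewrite exprS -[_ * _]/(_ *m _) -mulmxA addnS -addSn -IH (rec k).2.
move=> k; rewrite Qz -(vsubmxK (z k)) -/(u k) -/(d k) u0 (dH n) Hn mul0mx.
by rewrite col_mx0 mulmx0.
Qed.

Lemma zero_solution_unique (R : realType) (m p q : nat) (e : (p + q)%N = m)
    (F G : 'M[R]_m) (P Q : 'M[Cplx R]_m) (J : 'M[Cplx R]_p)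
    (H : 'M[Cplx R]_q) (Y : nat -> 'cV[R]_m) :
  weierstrass_form e F G P Q J H -> is_solution F G Y -> Y 0%N = 0 ->
  forall k, Y k = 0.
Proof.
subst m; move=> [[_ Qu] FE GE [n Hn] _] Ysol Y0 k.
rewrite !castmx_id in FE GE.
apply: (@map_mx_inj _ _ (real_complex R)); rewrite map_mx0.
apply: (descriptor_sequence_eq0 (y := fun k => mxC (Y k)) Qu FE GE Hn).
  by move=> j; rewrite /mxC -!map_mxM Ysol.
by rewrite Y0 /mxC map_mx0.
Qed.

(** * The stability criterion *)

Theorem theorem3p2 (R : realType) (m : nat) (F G : 'M[R]_m)
    (detF0 : \det F = 0) (regFG : regular_pencil F G)
    (p q : nat) (p_def : p = num_finite_eigenvalues F G)
    (pq_m : (p + q)%N = m)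
    (P Q : 'M[Cplx R]_m) (J : 'M[Cplx R]_p) (H : 'M[Cplx R]_q)
    (W : weierstrass_form pq_m F G P Q J H)
    (Qp : 'M[Cplx R]_(m, p)) (Qq : 'M[Cplx R]_(m, q))
    (Q_def : Q = castmx (erefl m, pq_m) (row_mx Qp Qq)) :
  asymptotically_stable_at_large F G Qp J <->
  (forall s : Cplx R, finite_eigenvalue F G s -> `|s| < 1).
Proof.
clear p_def; subst m; rewrite castmx_id in Q_def.
have [[_ Qu] _ _ _ [_ eigJ]] := W.
have QpE : Qp = Q *m col_mx 1%:M 0.
  by rewrite Q_def mul_row_col mulmx1 mulmx0 addr0.
have LQp : row_mx 1%:M 0 *m invmx Q *m Qp = 1%:M.
  by rewrite QpE mulmxA mulmxKV // mul_row_col mulmx1 mul0mx addr0.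
have Gu := gram_unitmx LQp.
set L := invmx (Qp ^t* *m Qp) *m Qp ^t*.
have {LQp} LQp : L *m Qp = 1%:M by rewrite -mulmxA mulVmx.
have optE y k : optimal_solution Qp J y k = Qp *m J ^+ k *m L *m mxC y.
  by rewrite /optimal_solution !mulmxA.
clearbody L.
split=> [[Ystar [_ stable]] s|lt1].
  rewrite -eigJ; apply: eigenvalue_norm_lt1.
  have [y0 y0N] := exists_nonconsistent detF0 regFG.
  have diff0 y z : ~ consistent F G y -> ~ consistent F G z ->
      (optimal_solution Qp J (y - z) k @[k --> \oo] --> (0 : 'cV[Cplx R]__)).
    move=> /stable/cvg_mxP yY /stable/cvg_mxP zY.
    apply/cvg_mxP => i j; rewrite mxE -(subrr (mxC Ystar i j)).
    under eq_fun do rewrite optE /mxC map_mxB mulmxBr -!optE mxE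
      [in X in _ + X]mxE.
    by apply: cvgB; [exact: yY|exact: zY].
  (* A consistent y is (y + y0) - y0, any other y is (y + y) - y. *)
  have all0 y :
      (optimal_solution Qp J y k @[k --> \oo] --> (0 : 'cV[Cplx R]__)).
    have [yC|yN] := pselect (consistent F G y).
      rewrite -(addrK y0 y); apply: diff0 => // yy0.
      by apply: y0N; rewrite -(addKr y y0) addrC; exact: consistentB.
    rewrite -(addrK y y); apply: diff0 => // yy.
    apply: yN; have := consistentZ 2^-1 yy.
    have -> : y + y = 2 *: y by rewrite scaler_nat mulr2n.
    by rewrite scalerA mulVf ?scale1r ?pnatr_eq0.
  have T0 : Qp *m J ^+ k *m L @[k --> \oo] --> (0 : 'M[Cplx R]__).
    apply/cvg_mxP => i j; have /cvg_mxP/(_ i 0) := all0 (delta_mx j 0).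
    by rewrite !mxE; under eq_fun do rewrite optE /mxC map_delta_mx -colE mxE.
  have := cvg_mulmxr (B := Qp) (cvg_mulmxl (B := L) T0); rewrite mulmx0 mul0mx.
  by under eq_fun do rewrite !mulmxA LQp mul1mx -mulmxA LQp mulmx1.
exists 0; split.
  split; last by move=> Y Ysol Y0 k _; exact: zero_solution_unique W Ysol Y0 k.
  by exists (fun=> 0); split=> // k; rewrite !mulmx0.
move=> y _.
have J0 : J ^+ k @[k --> \oo] --> (0 : 'M[Cplx R]_p).
  by apply: spectral_radius_lt1_cvg0 => s; rewrite eigJ; exact: lt1.
rewrite /mxC map_mx0.
have := cvg_mulmxr (B := L *m mxC y) (cvg_mulmxl (B := Qp) J0).
rewrite mulmx0 mul0mx.
by under eq_fun do rewrite mulmxA -optE.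
Qed.
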